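(* Let $X$ be a finite-dimensional Euclidean or Hermitian space and $M\in\bigwedge X$. Any minimal blade decomposition $M=\sum_i B_i$ is balanced, that is, $\lfloor M\rfloor=\bigcap_i\lfloor B_i\rfloor$ and $\lceil M\rceil=\sum_i\lceil B_i\rceil$.
   Context: $X$ is a Euclidean (real) or Hermitian (complex) inner product space of finite dimension, with product $\langle\cdot,\cdot\rangle$ (conjugate-linear in the first argument in the complex case). $\bigwedge X$ is its exterior algebra with the induced inner product (different grades orthogonal, $\langle x_1\wedge\cdots\wedge x_p,y_1\wedge\cdots\wedge y_p\rangle=\det(\langle x_i,y_j\rangle)$). The left contraction $M\lrcorner N$ is defined by $\langle L,M\lrcorner N\rangle=\langle M\wedge L,N\rangle$ for all $L\in\bigwedge X$. A blade (simple multivector) is a scalar or an exterior product of vectors. The inner and outer spaces of $M\in\bigwedge X$ are $\lfloor M\rfloor=\{v\in X:v\wedge M=0\}$ and $\lceil M\rceil=\{v\in X:v\lrcorner M=0\}^\perp$. A blade decomposition of $M$ is an expression of $M$ as a finite sum of blades $M=\sum_i B_i$; it is minimal if no blade decomposition of $M$ has fewer blades. *)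

(* Defs.v *)
From HB Require Import structures.
From mathcomp Require Import all_boot all_order all_algebra sesquilinear complex ring zify.
From mathcomp Require boolp classical_sets reals.

Set Implicit Arguments.
Unset Strict Implicit.
Unset Printing Implicit Defensive.

Import Order.TTheory GRing.Theory Num.Theory.
Local Open Scope ring_scope.

(* The exterior algebra of K^n in coordinates: M : exterior K n is the family *)
(* of its coordinates M S on the basis e_S = e_i1 /\ ... /\ e_ip, for         *)
(* S = {i1 < ... < ip}. The exterior product is the ring product [*].         *)
Definition exterior (K : comNzRingType) (n : nat) : Type :=
  {ffun {set 'I_n} -> K^o}.

HB.instance Definition _ (K : comNzRingType) n :=
  GRing.Lmodule.copy (exterior K n) {ffun {set 'I_n} -> K^o}.

Section ExteriorAlgebra.
Variables (K : comNzRingType) (n : nat).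
Implicit Types (S T U : {set 'I_n}) (M N P : exterior K n).

(* For disjoint S and T, e_S /\ e_T = (-1) ^+ inversions S T *: e_(S :|: T).  *)
Definition inversions S T : nat := (\sum_(i in S) \sum_(j in T) (j < i))%N.

Definition wedge M N : exterior K n :=
  [ffun U : {set 'I_n} => \sum_(S : {set 'I_n} | S \subset U)
     (-1) ^+ inversions S (U :\: S) * M S * N (U :\: S)].

Definition ext_one : exterior K n := [ffun S => (S == set0)%:R].

Lemma exteriorP M N : (forall S, M S = N S) <-> M = N.
Proof. by split=> [/ffunP|->]. Qed.

Lemma inversions0l T : inversions set0 T = 0%N.
Proof. by rewrite /inversions big_set0. Qed.

Lemma inversions0r S : inversions S set0 = 0%N.
Proof. by rewrite /inversions big1 // => i _; rewrite big_set0. Qed.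

Lemma inversionsUl S T U :
  [disjoint S & T] -> inversions (S :|: T) U = (inversions S U + inversions T U)%N.
Proof.
by move=> dST; rewrite /inversions -bigU //=; apply: eq_bigl => i; rewrite !inE.
Qed.

Lemma inversionsUr S T U :
  [disjoint T & U] -> inversions S (T :|: U) = (inversions S T + inversions S U)%N.
Proof.
move=> dTU; rewrite /inversions -big_split; apply: eq_bigr => i _ /=.
by rewrite -bigU //=; apply: eq_bigl => j; rewrite !inE.
Qed.

Lemma wedgeA : associative wedge.
Proof.
move=> M N P; apply/ffunP => U; rewrite !ffunE.
under eq_bigr => R RU do rewrite ffunE mulr_sumr.
under [RHS]eq_bigr => S SU do rewrite ffunE mulr_sumr mulr_suml.
rewrite [RHS](exchange_big_dep (fun R : {set _} => R \subset U)) /=; last first.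
  by move=> S R SU RS; apply: subset_trans RS SU.
apply: eq_bigr => R RU.
rewrite [RHS](reindex_onto (fun Q => R :|: Q) (fun S => S :\: R)) /=; last first.
  by move=> S /andP[SU RS]; rewrite -{1}(setIidPr RS) setID.
apply: eq_big => [Q|Q].
  rewrite subsetD subUset RU subsetUl setDUl setDv set0U /= andbT.
  by rewrite (sameP eqP setDidPl).
rewrite subsetD => /andP[QU dQR].
have RQK : (R :|: Q) :\: R = Q by rewrite setDUl setDv set0U; apply/setDidPl.
rewrite RQK setDDl.
have eD : U :\: R = Q :|: (U :\: (R :|: Q)).
  rewrite -setDDl -{1}(setIidPr (_ : Q \subset U :\: R)) ?setID //.
  by rewrite subsetD QU.
have dRQ : [disjoint R & Q] by rewrite disjoint_sym.
rewrite (inversionsUl _ dRQ) {1}eD inversionsUr; last first.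
  by rewrite disjoint_sym disjoints_subset setDE subIset // setCS subsetUr orbT.
rewrite !exprD; set x := _ ^+ _; set y := _ ^+ _; set z := _ ^+ _.
suff aux (a b c : K) : x * y * a * (z * b * c) = y * z * (x * a * b) * c by [].
by ring.
Qed.

Lemma wedge1l : left_id ext_one wedge.
Proof.
move=> M; apply/ffunP => U; rewrite ffunE (bigD1 set0) ?sub0set //=.
rewrite ffunE eqxx inversions0l setD0 !mul1r big1 ?addr0 // => S /andP[_ nS].
by rewrite ffunE (negPf nS) mulr0 mul0r.
Qed.

Lemma wedge1r : right_id ext_one wedge.
Proof.
move=> M; apply/ffunP => U; rewrite ffunE (bigD1 U) ?subxx //=.
rewrite ffunE setDv eqxx inversions0r mul1r mulr1 big1 ?addr0 // => S /andP[SU nS].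
by rewrite ffunE setD_eq0 [U \subset S](contraNF _ nS) ?mulr0 // => US;
   rewrite eqEsubset SU.
Qed.

Lemma wedgeDl : left_distributive wedge +%R.
Proof.
move=> M N P; apply/ffunP => U; rewrite !ffunE -big_split /=.
by apply: eq_bigr => S _; rewrite ffunE mulrDr mulrDl.
Qed.

Lemma wedgeDr : right_distributive wedge +%R.
Proof.
move=> M N P; apply/ffunP => U; rewrite !ffunE -big_split /=.
by apply: eq_bigr => S _; rewrite ffunE mulrDr.
Qed.

Lemma ext_one_neq0 : ext_one != 0.
Proof.
by apply/eqP => /ffunP/(_ set0)/eqP; rewrite !ffunE eqxx oner_eq0.
Qed.

HB.instance Definition _ := GRing.Zmodule_isNzRing.Build (exterior K n)
  wedgeA wedge1l wedge1r wedgeDl wedgeDr ext_one_neq0.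

Lemma wedgeZl (a : K) M N : a *: (M * N) = a *: M * N.
Proof.
apply/ffunP => U; rewrite !ffunE [_ *: _]mulr_sumr.
apply: eq_bigr => S _; rewrite ffunE.
suff aux (x b c : K) : a * (x * b * c) = x * (a * b) * c by exact: aux.
by ring.
Qed.

HB.instance Definition _ :=
  GRing.Lmodule_isLalgebra.Build K (exterior K n) wedgeZl.

Lemma wedgeZr (a : K) M N : a *: (M * N) = M * (a *: N).
Proof.
apply/ffunP => U; rewrite !ffunE [_ *: _]mulr_sumr.
apply: eq_bigr => S _; rewrite ffunE.
suff aux (x b c : K) : a * (x * b * c) = x * b * (a * c) by exact: aux.
by ring.
Qed.

HB.instance Definition _ :=
  GRing.Lalgebra_isAlgebra.Build K (exterior K n) wedgeZr.

End ExteriorAlgebra.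

Section ExteriorTheory.
Variables (K : comNzRingType) (n : nat).
Implicit Types (S T U : {set 'I_n}) (M N : exterior K n) (u v : 'rV[K]_n).

(* The embedding of K^n as the grade one part. *)
Definition ext_vec v : exterior K n :=
  [ffun S => \sum_i (S == [set i])%:R * v 0 i].

Lemma ext_vec1 v i : ext_vec v [set i] = v 0 i.
Proof.
rewrite ffunE (bigD1 i) //= eqxx mul1r big1 ?addr0 // => j nji.
by rewrite (inj_eq set1_inj) eq_sym (negPf nji) mul0r.
Qed.

Lemma ext_vec_eq0 v S : #|S| != 1%N -> ext_vec v S = 0.
Proof.
move=> nS; rewrite ffunE big1 // => j _; case: eqP => [eS|]; last by rewrite mul0r.
by rewrite eS cards1 in nS.
Qed.

Lemma ext_vec_is_linear : linear ext_vec.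
Proof.
move=> a u v; apply/ffunP => S; rewrite !ffunE scaler_sumr -big_split /=.
apply: eq_bigr => i _; rewrite !mxE mulrDr; congr (_ + _).
exact: mulrCA.
Qed.

HB.instance Definition _ :=
  GRing.isLinear.Build K 'rV[K]_n (exterior K n) *:%R ext_vec ext_vec_is_linear.

Lemma ext_vecM v N U : (ext_vec v * N) U =
  \sum_(i in U) (-1) ^+ #|[set j in U | (j < i)%N]| * v 0 i * N (U :\ i).
Proof.
rewrite [LHS]ffunE.
under eq_bigr => S SU do rewrite ffunE mulr_sumr mulr_suml.
rewrite exchange_big /= [RHS]big_mkcond; apply: eq_bigr => i _.
have [iU|iU] := boolP (i \in U).
  rewrite (bigD1 [set i]) ?sub1set //= eqxx mul1r [X in _ + X]big1 ?addr0; last first.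
    by move=> S /andP[_ /negPf->]; rewrite mul0r mulr0 mul0r.
  congr ((-1) ^+ _ * _ * _); rewrite /inversions big_set1 -sum1_card.
  rewrite -big_mkcondr /=; apply: eq_bigl => j; rewrite !inE.
  by case: (eqVneq j i) => [->|_]; rewrite ?ltnn ?andbF.
rewrite big1 // => S SU; case: eqP => [eS|]; last by rewrite mul0r mulr0 mul0r.
by rewrite eS sub1set (negPf iU) in SU.
Qed.

Lemma prod_ext_vec_eq0 p (v : 'I_p -> 'rV[K]_n) S :
  #|S| != p -> (\prod_(i < p) ext_vec (v i)) S = 0.
Proof.
elim: p v S => [|p IH] v S.
  by rewrite big_ord0 ffunE cards_eq0 => /negPf->.
rewrite big_ord_recl ext_vecM => nS; rewrite big1 // => i iS.
by rewrite IH ?mulr0 //; move: nS; rewrite (cardsD1 i) iS.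
Qed.

Lemma prod_ext_vecE p (v : 'I_p -> 'rV[K]_n) (f : 'I_p -> 'I_n) :
  {mono f : i j / (i < j)%N} ->
  (\prod_(i < p) ext_vec (v i)) (f @: setT) = \det (\matrix_(i, j) v i 0 (f j)).
Proof.
elim: p v f => [|p IH] v f fP.
  rewrite big_ord0 det_mx00 ffunE (_ : _ == _) //.
  by rewrite -subset0; apply/subsetP => x /imsetP[[]].
have f_inj : injective f.
  by move=> i j eij; case: (ltngtP i j) => [||/ord_inj]//; rewrite -fP eij ltnn.
rewrite big_ord_recl ext_vecM big_imset /=; last by move=> i j _ _ /f_inj.
rewrite (expand_det_row _ ord0) (eq_bigl predT) => [|j]; last by rewrite inE.
apply: eq_bigr => j _; rewrite !mxE /cofactor add0n.
have -> : [set k in f @: setT | (k < f j)%N] = f @: [set k : 'I_p.+1 | (k < j)%N].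
  apply/setP => k; rewrite !inE; apply/andP/imsetP => [[/imsetP[l _ ->]]|[l]].
    by rewrite fP => lj; exists l; rewrite ?inE.
  by rewrite inE => lj ->; rewrite fP lj imset_f.
rewrite card_imset //.
have -> : #|[set k : 'I_p.+1 | (k < j)%N]| = j.
  rewrite cardsE -sum1_card -(big_ord_widen _ (fun=> 1%N)); last exact/ltnW/ltn_ord.
  by rewrite sum1_card card_ord.
have -> : f @: setT :\ f j = (f \o lift j) @: setT.
  apply/setP => k; rewrite !inE; apply/andP/imsetP => [[nk /imsetP[l _ ek]]|[l _ ->]].
    have [m em|em] := unliftP j l; first by exists m; rewrite // ek em.
    by rewrite ek em eqxx in nk.
  by rewrite /= imset_f // (inj_eq f_inj) eq_sym neq_lift.
rewrite IH; last first.
  by move=> a b /=; rewrite fP /= /bump; do 2 case: leqP => ? /=; lia.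
rewrite [RHS]mulrCA mulrA; congr (_ * \det _).
by apply/matrixP => a b; rewrite !mxE.
Qed.
End ExteriorTheory.

Section Minors.
Variable K : comNzRingType.

Lemma ord_sorted n : sorted (relpre val ltn) (index_enum 'I_n).
Proof.
by have := iota_ltn_sorted 0 n; rewrite -val_enum_ord sorted_map enumT.
Qed.

Lemma enum_val_mono n (S : {set 'I_n}) :
  {mono (@enum_val _ (mem S)) : i j / (i < j)%N}.
Proof.
have homo : {homo (@enum_val _ (mem S)) : i j / (i < j)%N}.
  move=> i j ij; rewrite (enum_val_nth (enum_val i)) [enum_val j](enum_val_nth (enum_val i)).
  have tr : transitive (relpre val ltn : rel 'I_n).
    by move=> a b c /=; apply: ltn_trans.
  apply: (sorted_ltn_nth tr) => //; rewrite ?inE -?cardE //.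
  by rewrite /enum_mem sorted_filter // ord_sorted.
move=> i j; apply/idP/idP => [|/homo //].
by case: (ltngtP i j) => [//|/homo ji /(ltn_trans ji)|/ord_inj->]; rewrite ltnn.
Qed.

Lemma enum_val_imset n (S : {set 'I_n}) : (@enum_val _ (mem S)) @: setT = S.
Proof.
apply/setP => i; apply/imsetP/idP => [[j _ ->]|iS]; first exact: enum_valP.
by exists (enum_rank_in iS i); rewrite ?enum_rankK_in.
Qed.

Lemma prod_ext_vec_enum n p (v : 'I_p -> 'rV[K]_n) (S : {set 'I_n}) (e : p = #|S|) :
  (\prod_(i < p) ext_vec (v i)) S =
  \det (\matrix_(i, j) v i 0 (enum_val (cast_ord e j))).
Proof.
subst p; have := prod_ext_vecE v (@enum_val_mono n S); rewrite enum_val_imset => ->.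
by congr (\det _); apply/matrixP => i j; rewrite !mxE cast_ord_id.
Qed.
End Minors.

Section Functor.
Variable K : comNzRingType.

Lemma ext_vec_sq n (v : 'rV[K]_n) : ext_vec v * ext_vec v = 0.
Proof.
have -> : ext_vec v * ext_vec v = \prod_(i < 2) ext_vec v.
  by rewrite !big_ord_recl big_ord0 mulr1.
apply/ffunP => S; rewrite [RHS]ffunE.
have [e|ne] := eqVneq #|S| 2; last exact: (prod_ext_vec_eq0 (fun=> v)).
rewrite (prod_ext_vec_enum (fun=> v) (esym e)).
by rewrite (@determinant_alternate _ _ _ ord0 ord_max) // => j; rewrite !mxE.
Qed.

Lemma ext_vecC n (u v : 'rV[K]_n) : ext_vec u * ext_vec v = - (ext_vec v * ext_vec u).
Proof.
apply/eqP; rewrite -addr_eq0; have := ext_vec_sq (u + v).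
rewrite linearD mulrDl !mulrDr !ext_vec_sq add0r addr0 => ->.
by rewrite eqxx.
Qed.

Variables (n m : nat) (A : 'M[K]_(n, m)).
Implicit Types (S : {set 'I_n}) (N : exterior K n).

Definition blade_rows S : exterior K m := \prod_(i in S) ext_vec (row i A).

Definition ext_map N : exterior K m := \sum_S N S *: blade_rows S.

Lemma ext_map_is_linear : linear ext_map.
Proof.
move=> a M N; rewrite /ext_map scaler_sumr -big_split /=.
by apply: eq_bigr => S _; rewrite !ffunE scalerDl scalerA.
Qed.

HB.instance Definition _ := GRing.isLinear.Build K (exterior K n) (exterior K m)
  *:%R ext_map ext_map_is_linear.

Lemma vec_blade_rows_seq0 (s : seq 'I_n) i S : i \in S -> i \in s ->
  ext_vec (row i A) * \prod_(j <- s | j \in S) ext_vec (row j A) = 0.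
Proof.
move=> iS; elim: s => // j s IH; rewrite inE big_cons.
have [<-|_] /= := eqVneq i j; first by rewrite iS mulrA ext_vec_sq mul0r.
by move=> /IH h; case: ifP => // _; rewrite mulrA ext_vecC mulNr -mulrA h mulr0 oppr0.
Qed.

Lemma vec_blade_rows_seq (s : seq 'I_n) i S : i \notin S -> i \in s ->
  sorted (relpre val ltn) s ->
  ext_vec (row i A) * \prod_(j <- s | j \in S) ext_vec (row j A) =
  (-1) ^+ (\sum_(j <- s | j \in S) (j < i)) *:
    \prod_(j <- s | j \in i |: S) ext_vec (row j A).
Proof.
move=> iS; elim: s => // j s IH; rewrite inE !big_cons.
have tr : transitive (relpre val ltn : rel 'I_n).
  by move=> a b c /=; apply: ltn_trans.
have [<-|nij] /= := eqVneq i j.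
  move=> _; rewrite (path_sortedE tr) => /andP[/allP lti _].
  rewrite (negPf iS) !inE eqxx /= [X in _ ^+ X]big_seq_cond [X in _ ^+ X]big1.
    rewrite scale1r.
  congr (_ * _); rewrite big_seq_cond [RHS]big_seq_cond; apply: eq_bigl => k.
  apply: andb_id2l => /lti /= ik; rewrite !inE; case: eqP => // eki.
  by rewrite eki ltnn in ik.
    by move=> k /andP[/lti /= ik _]; case: ltngtP ik.
move=> si; rewrite (path_sortedE tr) => /andP[/allP/(_ i si) /= ji ss].
rewrite !inE eq_sym (negPf nij) /=; case: ifP => jS; last exact: IH.
rewrite mulrA ext_vecC mulNr -mulrA IH // ji exprS mulN1r scaleNr.
by rewrite -scalerAr.
Qed.

Lemma ext_mapM (v : 'rV[K]_n) N :
  ext_map (ext_vec v * N) = ext_vec (v *m A) * ext_map N.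
Proof.
rewrite /ext_map mulr_sumr.
have -> : v *m A = \sum_i v 0 i *: row i A by exact: mulmx_sum_row.
under eq_bigr => U _ do rewrite ext_vecM scaler_suml.
under [RHS]eq_bigr => S _ do rewrite linear_sum mulr_suml.
rewrite (exchange_big_dep predT) // [RHS]exchange_big /=; apply: eq_bigr => i _.
rewrite [RHS](bigID (fun S : {set 'I_n} => i \in S)) /= [X in _ = X + _]big1 ?add0r.
  rewrite (reindex_onto (fun S => i |: S) (fun U => U :\ i)) /=; last first.
    by move=> U iU; rewrite setD1K.
  apply: eq_big => [S|S].
    rewrite setU11 /=; apply/eqP/idP => [<-|]; first by rewrite !inE eqxx.
    exact: setU1K.
  rewrite setU11 /= => /eqP eS; have iS : i \notin S by rewrite -eS !inE eqxx.
  rewrite eS linearZ -!scalerAl -!scalerAr vec_blade_rows_seq ?mem_index_enum ?ord_sorted //.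
    rewrite !scalerA; congr (_ *: _).
    rewrite -mulrA mulrC; congr (_ * (-1) ^+ _).
    rewrite -sum1_card -big_mkcondr /=; apply: eq_bigl => j; rewrite !inE.
    by case: (eqVneq j i) => [->|_]; rewrite ?ltnn ?andbF.
  move=> S iS; rewrite linearZ -!scalerAl -!scalerAr.
  by rewrite vec_blade_rows_seq0 ?mem_index_enum // !scaler0.
Qed.

Lemma ext_map1 : ext_map 1 = 1.
Proof.
rewrite /ext_map (bigD1 set0) //= ffunE eqxx scale1r /blade_rows big_set0.
by rewrite big1 ?addr0 // => S /negPf nS; rewrite ffunE nS scale0r.
Qed.

Lemma ext_map_prod I (r : seq I) (P : pred I) (v : I -> 'rV[K]_n) :
  ext_map (\prod_(i <- r | P i) ext_vec (v i)) =
  \prod_(i <- r | P i) ext_vec (v i *m A).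
Proof.
elim: r => [|i r IH]; first by rewrite !big_nil ext_map1.
by rewrite !big_cons; case: ifP => // _; rewrite ext_mapM IH.
Qed.

Lemma blade_rowsE S : blade_rows S = \prod_(i < #|S|) ext_vec (row (enum_val i) A).
Proof.
have map_enum : [seq enum_val i | i : 'I_#|S|] = enum S.
  rewrite -[RHS](map_tnth_enum (enum_tuple (mem S))); apply: eq_map => i.
  by rewrite (tnth_nth (enum_val i)) -enum_val_nth.
by rewrite /blade_rows -big_filter -[filter _ _]/(enum S) -map_enum big_map /image_mem enumT.
Qed.
End Functor.

Section CauchyBinet.
Variable K : comNzRingType.

Lemma blade_rows_minor n m (A : 'M[K]_(n, m)) (S : {set 'I_n}) (T : {set 'I_m}) (e : #|S| = #|T|) :
  blade_rows A S T =
  \det (\matrix_(i < #|S|, j < #|S|) A (enum_val i) (enum_val (cast_ord e j))).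
Proof.
rewrite blade_rowsE (prod_ext_vec_enum (fun i => row (enum_val i) A) e).
by congr (\det _); apply/matrixP => i j; rewrite !mxE.
Qed.

Lemma blade_rows_neq n m (A : 'M[K]_(n, m)) (S : {set 'I_n}) (T : {set 'I_m}) :
  #|S| != #|T| -> blade_rows A S T = 0.
Proof.
by move=> ne; rewrite blade_rowsE prod_ext_vec_eq0 // eq_sym.
Qed.

Lemma blade_rows_tr n m (A : 'M[K]_(n, m)) (S : {set 'I_n}) (T : {set 'I_m}) :
  blade_rows A S T = blade_rows A^T T S.
Proof.
have [e|ne] := eqVneq #|S| #|T|; last by rewrite !blade_rows_neq // eq_sym.
rewrite (blade_rows_minor _ e) (blade_rows_minor _ (esym e)) -det_tr.
move: e (esym e); move: (#|T|) (@enum_val _ (mem T)) => p f e; subst p => e.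
by congr (\det _); apply/matrixP => i j; rewrite !mxE !cast_ord_id.
Qed.

Lemma sum_prod_ext_vec n p (x y : 'I_p -> 'rV[K]_n) :
  \sum_S (\prod_i ext_vec (x i)) S * (\prod_j ext_vec (y j)) S =
  \det (\matrix_(i, j) \sum_k x i 0 k * y j 0 k).
Proof.
pose H := \matrix_(k < n, j < p) y j 0 k.
have ctT : p = #|[set: 'I_p]| by rewrite cardsT card_ord.
have eV j : enum_val (cast_ord ctT j) = j.
  apply/ord_inj; rewrite (enum_val_nth j) /= enum_setT -enumT nth_enum_ord //.
transitivity (ext_map H (\prod_i ext_vec (x i)) setT).
  rewrite /ext_map sum_ffunE; apply: eq_bigr => S _; rewrite ffunE.
  congr (_ * _); rewrite blade_rows_tr.
  rewrite /blade_rows; congr (fun_of_fin _ S); apply: eq_big => j; rewrite ?inE //.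
  by move=> _; congr ext_vec; apply/rowP => k; rewrite !mxE.
rewrite ext_map_prod (prod_ext_vec_enum (fun i => x i *m H) ctT).
congr (\det _); apply/matrixP => i j; rewrite !mxE eV.
by apply: eq_bigr => k _; rewrite mxE.
Qed.

Lemma ext_map_comp n m p (A : 'M[K]_(n, m)) (B : 'M[K]_(m, p)) N :
  ext_map B (ext_map A N) = ext_map (A *m B) N.
Proof.
rewrite [ext_map A N]/ext_map linear_sum; apply: eq_bigr => S _; rewrite linearZ /=.
by rewrite /blade_rows ext_map_prod; congr (_ *: _); apply: eq_bigr => i _; rewrite row_mul.
Qed.

Lemma ext_map_id n (N : exterior K n) : ext_map 1%:M N = N.
Proof.
apply/ffunP => T; rewrite /ext_map sum_ffunE (bigD1 T) //= ffunE.
rewrite [X in _ + X]big1 ?addr0 => [|S nST].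
  rewrite (blade_rows_minor _ erefl) (_ : \matrix_(i, j) _ = 1%:M) ?det1 ?mulr1.
    exact: mulr1.
  by apply/matrixP => i j; rewrite !mxE cast_ord_id (inj_eq enum_val_inj).
rewrite ffunE; have [e|ne] := eqVneq #|S| #|T|; last first.
  by rewrite blade_rows_neq // scaler0.
rewrite (blade_rows_minor _ e); have /subsetPn[i iS iT] : ~~ (S \subset T).
  by apply: contra nST => sST; rewrite eqEcard sST e leqnn.
rewrite (expand_det_row _ (enum_rank_in iS i)) big1 ?scaler0 // => j _.
rewrite !mxE enum_rankK_in //; case: eqP => [eij|]; last by rewrite mul0r.
by rewrite eij enum_valP in iT.
Qed.
End CauchyBinet.

Import boolp classical_sets.

Notation multivector K X := (exterior K (\dim (@fullv K X))).

Section Multivectors.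
Variables (K : numFieldType) (theta : K -> K) (X : vectType K).
Variable g : {dot X for theta}.
Implicit Types (M N L B : multivector K X) (v : X).

(* X is identified with K^n by means of the basis (vbasis fullv) of X.        *)
Definition vec v : multivector K X := ext_vec (\row_i coord (vbasis fullv) i v).

(* The forms of sesquilinear.v are conjugate-linear in their second argument, *)
(* whereas dotp is conjugate-linear in the first one.                         *)
Definition dotp (u v : X) : K := g v u.

Let b (i : 'I_(\dim (@fullv _ X))) : X := (vbasis fullv)`_i.

(* The product of e_S and e_T, extended sesquilinearly by ext_dotp; by lemmas *)
(* ext_dotp_prod and ext_dotp_grade, ext_dotp has the defining properties of  *)
(* the induced inner product: determinant formula and orthogonal grades.      *)
Definition gram (S T : {set 'I_(\dim (@fullv _ X))}) : K :=
  if #|S| =P #|T| is ReflectT eST then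
    \det (\matrix_(i < #|S|, j < #|S|)
            dotp (b (enum_val i)) (b (enum_val (cast_ord eST j))))
  else 0.

Definition ext_dotp M N : K := \sum_S \sum_T theta (M S) * gram S T * N T.

(* The left contraction, determined by its adjunction with the exterior       *)
(* product: see contractionP and contraction_unique.                          *)
Definition contraction M N : multivector K X :=
  xget 0 [set P : multivector K X | forall L, ext_dotp L P = ext_dotp (M * L) N]%classic.

(* The empty product is the scalar 1. *)
Definition is_blade B : Prop :=
  (exists c : K, B = c%:A) \/ (exists s : seq X, B = \prod_(v <- s) vec v).

Definition inner_space M : set X := [set v | vec v * M = 0]%classic.

Definition orthogonal_complement (A : set X) : set X :=
  [set u | forall w, A w -> dotp w u = 0]%classic.

Definition outer_space M : set X :=
  orthogonal_complement [set v | contraction (vec v) M = 0]%classic.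

Definition subspace_sum k (A : 'I_k -> set X) : set X :=
  [set u | exists2 v : 'I_k -> X, (forall i, A i (v i)) & u = \sum_i v i]%classic.

Definition blade_decomposition M k (B : 'I_k -> multivector K X) : Prop :=
  (forall i, is_blade (B i)) /\ M = \sum_i B i.

Definition minimal_blade_decomposition M k (B : 'I_k -> multivector K X) : Prop :=
  blade_decomposition M B /\
  forall k' (B' : 'I_k' -> multivector K X), blade_decomposition M B' -> (k <= k')%N.

Definition balanced M k (B : 'I_k -> multivector K X) : Prop :=
  inner_space M = (\bigcap_i inner_space (B i))%classic /\
  outer_space M = subspace_sum (fun i => outer_space (B i)).
End Multivectors.

Section MultivectorTheory.
Variables (K : numFieldType) (theta : {rmorphism K -> K}) (X : vectType K).
Variable g : {dot X for theta}.
Implicit Types (M N L B : multivector K X) (v : X).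
Local Notation n := (\dim (@fullv _ X)).
Local Notation b i := (vbasis (@fullv _ X))`_i.

Let G := \matrix_(i < n, j < n) dotp g (b i) (b j).

Lemma vec_sq v : vec v * vec v = 0.
Proof. exact: ext_vec_sq. Qed.

Lemma vec_is_linear : linear (@vec K X).
Proof.
move=> a u v; rewrite /vec -linearP; congr ext_vec.
by apply/rowP => i; rewrite !mxE linearP.
Qed.

HB.instance Definition _ :=
  GRing.isLinear.Build K X (multivector K X) *:%R (@vec K X) vec_is_linear.

Lemma gram_blade_rows S T : gram g S T = blade_rows G^T T S.
Proof.
rewrite -blade_rows_tr /gram; case: eqP => [e|/eqP ne]; last by rewrite blade_rows_neq.
rewrite (blade_rows_minor _ e).
by congr (\det _); apply/matrixP => i j; rewrite !mxE.
Qed.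

Lemma ext_dotpE M N : ext_dotp g M N = \sum_S theta (M S) * ext_map G^T N S.
Proof.
apply: eq_bigr => S _; rewrite /ext_map sum_ffunE mulr_sumr.
apply: eq_bigr => T _; rewrite ffunE gram_blade_rows -mulrA; congr (_ * _).
exact: mulrC.
Qed.

Lemma dotp_sumr I r (P : pred I) (F : I -> X) u :
  dotp g u (\sum_(i <- r | P i) F i) = \sum_(i <- r | P i) dotp g u (F i).
Proof. exact: linear_sumlz. Qed.

Lemma dotp_suml I r (P : pred I) (F : I -> X) u :
  dotp g (\sum_(i <- r | P i) F i) u = \sum_(i <- r | P i) dotp g (F i) u.
Proof. exact: linear_sumr. Qed.

Lemma dotpZr a u v : dotp g u (a *: v) = a * dotp g u v.
Proof. exact: linearZl_LR. Qed.

Lemma dotpZl a u v : dotp g (a *: u) v = theta a * dotp g u v.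
Proof. exact: linearZr_LR. Qed.

Lemma dotp_coord u v : dotp g u v =
  \sum_i \sum_j theta (coord (vbasis fullv) i u) * G i j * coord (vbasis fullv) j v.
Proof.
rewrite {1}(coord_vbasis (memvf u)) {1}(coord_vbasis (memvf v)) dotp_suml.
apply: eq_bigr => i _; rewrite dotp_sumr; apply: eq_bigr => j _.
by rewrite dotpZl dotpZr mxE -mulrA [_ * coord _ _ _]mulrC.
Qed.

Lemma theta_prod_ext_vec p (x : 'I_p -> 'rV[K]_n) S :
  theta ((\prod_i ext_vec (x i)) S) =
  (\prod_i ext_vec (map_mx theta (x i))) S.
Proof.
have [e|ne] := eqVneq p #|S|; last by rewrite !prod_ext_vec_eq0 ?rmorph0 // eq_sym.
rewrite !(prod_ext_vec_enum _ e) -det_map_mx; congr (\det _).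
by apply/matrixP => i j; rewrite !mxE.
Qed.

Lemma ext_dotp_prod p (x y : 'I_p -> X) :
  ext_dotp g (\prod_i vec (x i)) (\prod_j vec (y j)) =
  \det (\matrix_(i, j) dotp g (x i) (y j)).
Proof.
pose cx (i : 'I_p) : 'rV[K]_n := \row_k coord (vbasis fullv) k (x i).
pose cy (i : 'I_p) : 'rV[K]_n := \row_k coord (vbasis fullv) k (y i).
have -> : ext_dotp g (\prod_i vec (x i)) (\prod_j vec (y j)) =
    \sum_S (\prod_i ext_vec (map_mx theta (cx i))) S
          * (\prod_j ext_vec (cy j *m G^T)) S.
  rewrite ext_dotpE; apply: eq_bigr => S _; congr (_ * _).
    exact: (theta_prod_ext_vec cx).
  by congr (fun_of_fin _ S); apply: (ext_map_prod _ _ _ cy).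
rewrite sum_prod_ext_vec; congr (\det _); apply/matrixP => i j.
rewrite [LHS]mxE [RHS]mxE dotp_coord; apply: eq_bigr => k _.
rewrite !mxE mulr_sumr; apply: eq_bigr => l _; rewrite !mxE -mulrA; congr (_ * _).
exact: mulrC.
Qed.

Lemma ext_dotp_grade p q (x : 'I_p -> X) (y : 'I_q -> X) : p != q ->
  ext_dotp g (\prod_i vec (x i)) (\prod_j vec (y j)) = 0.
Proof.
move=> npq; rewrite /vec ext_dotpE big1 // => S _; rewrite ext_map_prod.
have [e|ne] := eqVneq #|S| p; last by rewrite prod_ext_vec_eq0 // rmorph0 mul0r.
by rewrite [X in _ * X]prod_ext_vec_eq0 ?mulr0 // e.
Qed.

Lemma dotp_eq0 u : dotp g u u = 0 -> u = 0.
Proof.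
move=> u0; apply/eqP; apply/negPn/negP => /(@neq0_dnorm_gt0 _ _ _ g).
by rewrite -[g u u]/(dotp g u u) u0 ltxx.
Qed.

Lemma gram_unit : G^T \in unitmx.
Proof.
rewrite -row_free_unit; apply: inj_row_free => v vG0.
pose y := \sum_j v 0 j *: b j.
have yc j : coord (vbasis fullv) j y = v 0 j.
  by rewrite coord_sum_free // (basis_free (vbasisP _)).
have : dotp g y y = 0.
  rewrite dotp_coord big1 // => i _.
  have := congr1 (fun w : 'rV__ => w 0 i) vG0; rewrite !mxE => {}vG0.
  transitivity (theta (v 0 i) * \sum_j v 0 j * G^T j i); last by rewrite vG0 mulr0.
  rewrite mulr_sumr; apply: eq_bigr => j _.
  by rewrite !yc [G^T _ _]mxE -mulrA [_ * v 0 j]mulrC.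
move/dotp_eq0 => y0; apply/rowP => j; rewrite -yc y0 linear0 mxE //.
Qed.

Lemma ext_dotpDl M N L : ext_dotp g (M + N) L = ext_dotp g M L + ext_dotp g N L.
Proof.
by rewrite !ext_dotpE -big_split; apply: eq_bigr => S _; rewrite ffunE rmorphD mulrDl.
Qed.

Lemma ext_dotpZl a M N : ext_dotp g (a *: M) N = theta a * ext_dotp g M N.
Proof.
rewrite !ext_dotpE mulr_sumr; apply: eq_bigr => S _.
by rewrite ffunE -[a *: _]/(a * _) rmorphM mulrA.
Qed.

Let e_ (S : {set 'I_n}) : multivector K X := [ffun T => (T == S)%:R].

Let e_sum M : M = \sum_S M S *: e_ S.
Proof.
apply/ffunP => T; rewrite sum_ffunE (bigD1 T) //= !ffunE eqxx big1 ?addr0.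
  by rewrite -[_ *: _]/(_ * _) mulr1.
by move=> S nST; rewrite !ffunE eq_sym (negPf nST) scaler0.
Qed.

Lemma contraction_exists M N :
  exists P : multivector K X, forall L, ext_dotp g L P = ext_dotp g (M * L) N.
Proof.
pose c : multivector K X := [ffun S => ext_dotp g (M * e_ S) N].
exists (ext_map (invmx G^T) c) => L; rewrite ext_dotpE ext_map_comp.
rewrite mulVmx ?gram_unit // ext_map_id {2}[L]e_sum mulr_sumr.
have -> : ext_dotp g (\sum_S M * (L S *: e_ S)) N =
          \sum_S ext_dotp g (M * (L S *: e_ S)) N.
  elim/big_ind2: _ => // [|x1 y1 x2 y2 <- <-]; last by rewrite ext_dotpDl.
  by rewrite -[0]/(0 : multivector K X) -(scale0r (0 : multivector K X)) ext_dotpZl rmorph0 mul0r.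
by apply: eq_bigr => S _; rewrite ffunE -scalerAr ext_dotpZl.
Qed.

Lemma ext_dotp_inj P Q :
  (forall L, ext_dotp g L P = ext_dotp g L Q) -> P = Q.
Proof.
move=> PQ; suff : ext_map G^T P = ext_map G^T Q.
  by move/(congr1 (ext_map (invmx G^T))); rewrite !ext_map_comp mulmxV ?gram_unit // !ext_map_id.
apply/ffunP => S; have := PQ (e_ S); rewrite !ext_dotpE.
have eS R : \sum_T theta (e_ S T) * ext_map G^T R T = ext_map G^T R S.
  rewrite (bigD1 S) //= ffunE eqxx rmorph1 mul1r big1 ?addr0 // => T /negPf nTS.
  by rewrite ffunE nTS rmorph0 mul0r.
by rewrite !eS.
Qed.

Lemma contractionP M N L :
  ext_dotp g L (contraction g M N) = ext_dotp g (M * L) N.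
Proof.
have [P PP] := contraction_exists M N; move: L.
rewrite /contraction; case: xgetP => [Q -> //|/(_ P) nP].
by case: nP.
Qed.

Lemma contraction_unique M N P :
  (forall L, ext_dotp g L P = ext_dotp g (M * L) N) -> P = contraction g M N.
Proof. by move=> PP; apply: ext_dotp_inj => L; rewrite PP contractionP. Qed.
End MultivectorTheory.

(* Main.v *)
From HB Require Import structures.
Require Import Defs.
From mathcomp Require Import all_boot all_order all_algebra sesquilinear complex.
From mathcomp Require Import reals.
From mathcomp Require Import boolp classical_sets.

Set Implicit Arguments.
Unset Strict Implicit.
Unset Printing Implicit Defensive.

Import Order.TTheory GRing.Theory Num.Theory.
Local Open Scope ring_scope.
Local Open Scope complex_scope.

(* Everything rests on the shears [x |-> x - <t, x> u] and the algebra
   endomorphisms of the exterior algebra that they induce.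

   If [v /\ M = 0] but [v] is not in the span of the factors of [B_i], choose
   [t] orthogonal to these factors with [<t, v> = 1]. The map [pi] induced by
   the shear along [u = v] kills [M], so [M] is the sum of the [B_j - pi B_j].
   These are again blades, since at most one factor of [B_j] need be
   non-orthogonal to [t], and the [i]-th one vanishes: [M] would be a sum of
   fewer blades.

   If [v] contracts [M] to 0 but is not orthogonal to some factor [x] of
   [B_i], take [t = v] and [u] the multiple of [x] with [<v, u> = 1]. The
   adjoint of [pi] is induced by [x |-> x - <u, x> v], which is the identity
   modulo [v], so that [pi M = M]; but [pi B_i = 0], and [M] would again be a
   sum of fewer blades. Taking orthogonal complements turns this into the
   statement on outer spaces. *)

(** * Linear maps induced on exterior algebras *)

Lemma prodr_seq_eq0 (R : pzRingType) (I : eqType) (r : seq I) (P : pred I)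
    (F : I -> R) i :
  i \in r -> P i -> F i = 0 -> \prod_(j <- r | P j) F j = 0.
Proof.
by case/splitPr => r1 r2 Pi Fi; rewrite big_cat big_cons /= Pi Fi mul0r mulr0.
Qed.

(** The matrix of [ext_map A] consists of the minors of [A], and transposing [A] transposes it. *)
Lemma ext_map_pairing (K : comNzRingType) n m (A : 'M[K]_(n, m))
    (M : exterior K m) (N : exterior K n) :
  \sum_S M S * ext_map A N S = \sum_S ext_map A^T M S * N S.
Proof.
under eq_bigr => S _ do rewrite /ext_map sum_ffunE mulr_sumr.
under [RHS]eq_bigr => S _ do rewrite /ext_map sum_ffunE mulr_suml.
rewrite exchange_big /=; apply: eq_bigr => T _; apply: eq_bigr => S _.
rewrite !ffunE -blade_rows_tr -[N T *: _]/(N T * _) -[M S *: _]/(M S * _).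
by rewrite mulrCA mulrC.
Qed.

(** Minors commute with ring morphisms; this carries [theta] through the semilinear argument of
    [ext_dotp]. *)
Lemma map_ext_map (K L : comNzRingType) (f : {rmorphism K -> L}) n m
    (A : 'M[K]_(n, m)) (N : exterior K n) T :
  f (ext_map A N T) = ext_map (map_mx f A) [ffun S => f (N S)] T.
Proof.
rewrite /ext_map !sum_ffunE rmorph_sum; apply: eq_bigr => S _; rewrite !ffunE.
rewrite -[N S *: _]/(N S * _) -[f (N S) *: _]/(f (N S) * _) rmorphM; congr (_ * _).
have [e|ne] := eqVneq #|S| #|T|; last by rewrite !blade_rows_neq // rmorph0.
rewrite !(blade_rows_minor _ e) -det_map_mx; congr (\det _).
by apply/matrixP => i j; rewrite !mxE.
Qed.

(* A change of basis sending [v] to a multiple of [e_i] turns [v /\ M = 0] into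
   [M S = 0] for all [S] avoiding [i]. *)
Lemma ext_map_ann (K : fieldType) n m (v : 'rV[K]_n) (A : 'M[K]_(n, m))
    (M : exterior K n) :
  v != 0 -> v *m A = 0 -> ext_vec v * M = 0 -> ext_map A M = 0.
Proof.
case: n => [|n] in v A M *; first by rewrite [v]thinmx0 eqxx.
move=> v0 vA vM; pose P := row_ebase v; have Pu : P \in unitmx by exact: row_ebase_unit.
have [c ec] : exists c, v *m invmx P = c *: delta_mx 0 ord0.
  (* Gaussian elimination writes [v], of rank 1, as the 1 by 1 matrix [col_ebase v] times the first
     row of [P]. *)
  exists (col_ebase v 0 0); rewrite -{1}[v]mulmx_ebase mulmxK // rank_rV v0.
  rewrite {1}[col_ebase v]mx11_scalar mul_scalar_mx; congr (_ *: _).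
  by apply/rowP => j; rewrite !mxE eqxx andTb -val_eqE /= eq_sym; case: (val j).
have c0 : c != 0.
  by apply: contra_neq v0 => c0; rewrite -[v](mulmxKV Pu) ec c0 scale0r mul0mx.
pose M' := ext_map (invmx P) M.
have vM' : ext_vec (c *: delta_mx 0 ord0) * M' = 0.
  by rewrite -ec -ext_mapM vM linear0.
have rowP0 : row ord0 (P *m A) = 0.
  apply: (scalerI c0); rewrite scaler0 rowE scalemxAl -ec mulmxA.
  by rewrite mulmxKV.
rewrite -[A](mulKmx Pu) -ext_map_comp -/M' /ext_map big1 // => S _.
have [S0|S0] := boolP (ord0 \in S).
  rewrite /blade_rows (prodr_seq_eq0 (mem_index_enum ord0) S0) ?scaler0 //.
  by rewrite rowP0 linear0.
(* Only [i = ord0] contributes to this coordinate, giving [c * M' S] up to sign. *)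
have /exteriorP/(_ (ord0 |: S)) := vM'.
rewrite ext_vecM (bigD1 ord0) ?setU11 //= setU1K // big1 => [|i /andP[_ /negPf i0]].
  rewrite addr0 !mxE !eqxx mulr1 [RHS]ffunE => /eqP.
  by rewrite !mulf_eq0 signr_eq0 (negPf c0) /= => /eqP->; rewrite scale0r.
by rewrite !mxE i0 andbF mulr0 mulr0 mul0r.
Qed.

(** * Shears and their adjoints *)

Section Shear.
Variables (K : numFieldType) (theta : {rmorphism K -> K}) (X : vectType K).
Variable g : {dot X for theta}.
Local Notation n := (\dim (@fullv _ X)).
Local Notation b i := (vbasis (@fullv _ X))`_i.
Implicit Types (M N L B : multivector K X) (u v t : X).

Lemma dotpC u v : dotp g u v = theta (dotp g v u).
Proof. by rewrite /dotp hermC expr0 mul1r. Qed.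

Definition coords v : 'rV[K]_n := \row_i coord (vbasis fullv) i v.

(** When [dotp g t u = 1], this is the projection along [u] onto the orthogonal complement of
    [t]. *)
Definition shear t u v : X := v - dotp g t v *: u.

Definition shear_mx t u : 'M[K]_n := 1%:M - (\col_i dotp g t (b i)) *m coords u.

Lemma coords_shear t u v : coords (shear t u v) = coords v *m shear_mx t u.
Proof.
rewrite mulmxBr mulmx1 mulmxA; set c := coords v *m _.
have -> : c = (dotp g t v)%:M.
  rewrite [c]mx11_scalar; congr (_%:M); rewrite !mxE {2}(coord_vbasis (memvf v)).
  by rewrite dotp_sumr; apply: eq_bigr => i _; rewrite dotpZr !mxE.
by rewrite mul_scalar_mx; apply/rowP => i; rewrite !mxE linearB linearZ.
Qed.

Definition ext_shear t u M : multivector K X := ext_map (shear_mx t u) M.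

HB.instance Definition _ t u :=
  GRing.Linear.copy (ext_shear t u) (ext_map (shear_mx t u)).

Lemma ext_shear_prod t u (s : seq X) :
  ext_shear t u (\prod_(x <- s) vec x) = \prod_(x <- s) vec (shear t u x).
Proof.
rewrite /ext_shear (ext_map_prod _ s xpredT coords).
by apply: eq_bigr => x _; rewrite -coords_shear.
Qed.

Lemma ext_shearM t u v M :
  ext_shear t u (vec v * M) = vec (shear t u v) * ext_shear t u M.
Proof. by rewrite /ext_shear ext_mapM -/(coords v) -coords_shear. Qed.

Lemma ext_dotp_shear t u L M :
  ext_dotp g L (ext_shear t u M) = ext_dotp g (ext_shear u t L) M.
Proof.
rewrite !ext_dotpE /ext_shear ext_map_comp.
set G := \matrix_(i, j) _.
(* Adjunction in grade one, as a matrix identity; functoriality of [ext_map] extends it to every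
   grade. *)
have -> : shear_mx t u *m G^T = G^T *m (map_mx theta (shear_mx u t))^T.
  rewrite /shear_mx map_mxB map_mx1 map_mxM linearB /= trmx1 trmx_mul.
  rewrite mulmxBl mulmxBr mul1mx mulmx1 -mulmxA [in RHS]mulmxA; congr (_ - _ *m _).
    apply/colP => i; rewrite !mxE dotpC [in LHS](coord_vbasis (memvf t)) dotp_sumr.
    rewrite rmorph_sum; apply: eq_bigr => j _.
    by rewrite dotpZr rmorphM !mxE -dotpC mulrC.
  apply/rowP => i; rewrite !mxE -dotpC {2}(coord_vbasis (memvf u)) dotp_sumr.
  by apply: eq_bigr => j _; rewrite dotpZr !mxE.
rewrite -ext_map_comp.
under [RHS]eq_bigr => S _ do rewrite map_ext_map.
have := ext_map_pairing (map_mx theta (shear_mx u t))^T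
   [ffun S => theta (L S)] (ext_map G^T M).
by rewrite trmxK => <-; apply: eq_bigr => S _; rewrite ffunE.
Qed.

(** * Blades under shears *)

Lemma ext_shear_blade0 t u x (s : seq X) :
  x \in s -> shear t u x = 0 -> ext_shear t u (\prod_(y <- s) vec y) = 0.
Proof.
by move=> xs x0; rewrite ext_shear_prod (prodr_seq_eq0 xs) // x0 linear0.
Qed.

Lemma ext_shear_fix t u (s : seq X) : {in s, forall x, dotp g t x = 0} ->
  ext_shear t u (\prod_(x <- s) vec x) = \prod_(x <- s) vec x.
Proof.
move=> ts; rewrite ext_shear_prod; apply: eq_big_seq => x xs.
by rewrite /shear ts // scale0r subr0.
Qed.

Lemma vec_mul_factor0 v (s : seq X) : v \in s -> vec v * \prod_(x <- s) vec x = 0.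
Proof.
elim: s => // y s IH; rewrite inE big_cons mulrA => /orP[/eqP->|vs].
  by rewrite vec_sq mul0r.
by rewrite /vec ext_vecC -/(vec v) -/(vec y) mulNr -mulrA IH // mulr0 oppr0.
Qed.

Lemma vec_mul_blade0 v (s : seq X) :
  v \in <<s>>%VS -> vec v * \prod_(x <- s) vec x = 0.
Proof.
rewrite -[s in <<s>>%VS]in_tupleE => /coord_span->.
rewrite linear_sum mulr_suml big1 // => i _.
by rewrite linearZ -scalerAl vec_mul_factor0 ?scaler0 // mem_nth.
Qed.

(** A scalar is a multiple of the empty product; otherwise the first factor absorbs the
    coefficient. *)
Lemma is_bladeP B :
  is_blade B <-> exists c (s : seq X), B = c *: \prod_(x <- s) vec x.
Proof.
split=> [[[c ->]|[s ->]]|[c [[|x s] ->]]].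
- by exists c, [::]; rewrite big_nil.
- by exists 1, s; rewrite scale1r.
- by left; exists c; rewrite big_nil.
- by right; exists (c *: x :: s); rewrite !big_cons linearZ scalerAl.
Qed.

Lemma is_blade_shear t u B : is_blade B -> is_blade (ext_shear t u B).
Proof.
case/is_bladeP => c [s ->]; apply/is_bladeP; exists c, (map (shear t u) s).
by rewrite linearZ /= ext_shear_prod big_map.
Qed.

(** Gaussian elimination among the factors leaves at most one that is not orthogonal to [t]. *)
Lemma blade_isolate t (s : seq X) : {in s, forall x, dotp g t x = 0} \/
  exists u s', {in s', forall x, dotp g t x = 0} /\
    \prod_(x <- s) vec x = vec u * \prod_(x <- s') vec x.
Proof.
elim: s => [|x s [ts|[u [s' [ts' es]]]]]; first by left.
  right; exists x, s; split=> //; exact: big_cons.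
have [u0|u0] := eqVneq (dotp g t u) 0.
  right; exists x, (u :: s'); rewrite !big_cons es; split=> // y.
  by rewrite inE => /orP[/eqP->|/ts'].
(* Subtracting a multiple of [u] from [x] preserves their product; the sign pays for putting [u]
   first. *)
right; exists (- u), ((x - (dotp g t x / dotp g t u) *: u) :: s').
rewrite !big_cons es; split=> [y|].
  rewrite inE => /orP[/eqP->|/ts' //].
  by rewrite /dotp linearBl /= -!/(dotp _ _ _) dotpZr divfK // subrr.
rewrite !linearB linearN linearZ /= !mulrA mulNr mulrBr -scalerAr vec_sq scaler0.
by rewrite subr0 /vec ext_vecC.
Qed.

(** The two blades share their factors orthogonal to [t]; the remaining factor [u] contributes
    [u - shear t v u], a multiple of [v]. *)
Lemma is_blade_sub_shear t v B : is_blade B -> is_blade (B - ext_shear t v B).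
Proof.
case/is_bladeP => c [s ->]; rewrite linearZ -scalerBr /=.
have [ts|[u [s' [ts' ->]]]] := blade_isolate t s.
  by apply/is_bladeP; exists 0, [::]; rewrite (ext_shear_fix _ ts) subrr scale0r scaler0.
apply/is_bladeP; exists c, (dotp g t u *: v :: s').
rewrite ext_shearM ext_shear_fix // -mulrBl big_cons -linearB.
by rewrite /shear opprB addrC subrK.
Qed.

Lemma ext_shear_ann t v M :
  dotp g t v = 1 -> vec v * M = 0 -> ext_shear t v M = 0.
Proof.
move=> tv; apply: ext_map_ann; last first.
  rewrite -/(coords v) -coords_shear /shear tv scale1r subrr.
  by apply/rowP => i; rewrite !mxE linear0.
apply/eqP => /rowP v0; move/eqP: tv; rewrite (coord_vbasis (memvf v)) dotp_sumr big1.
  by rewrite eq_sym oner_eq0.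
by move=> i _; have := v0 i; rewrite !mxE dotpZr => ->; rewrite mul0r.
Qed.

(** * Contraction by a vector *)

Lemma ext_dotpDr L M N : ext_dotp g L (M + N) = ext_dotp g L M + ext_dotp g L N.
Proof.
by rewrite !ext_dotpE -big_split; apply: eq_bigr => S _; rewrite linearD ffunE mulrDr.
Qed.

Lemma ext_dotp0l M : ext_dotp g 0 M = 0.
Proof. by rewrite ext_dotpE big1 // => S _; rewrite ffunE rmorph0 mul0r. Qed.

Lemma ext_dotp0r M : ext_dotp g M 0 = 0.
Proof. by rewrite ext_dotpE big1 // => S _; rewrite linear0 ffunE mulr0. Qed.

Lemma contraction_eq0P v M :
  contraction g (vec v) M = 0 <-> forall L, ext_dotp g (vec v * L) M = 0.
Proof.
split=> [vM L|vM]; first by rewrite -contractionP vM ext_dotp0r.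
by apply/esym/contraction_unique => L; rewrite ext_dotp0r vM.
Qed.

(** The matrix fixes vectors modulo [v], hence products of vectors modulo the ideal of [v], and such
    products span. *)
Lemma ext_map_rank1 (l : 'cV[K]_n) (v : X) L : exists N,
  ext_map (1%:M - l *m coords v) L = L + vec v * N.
Proof.
set A := _ - _; pose P L := exists N, ext_map A L = L + vec v * N.
have PD L1 L2 : P L1 -> P L2 -> P (L1 + L2).
  by move=> [N1 e1] [N2 e2]; exists (N1 + N2); rewrite linearD /= e1 e2 mulrDr addrACA.
have PZ a L1 : P L1 -> P (a *: L1).
  by move=> [N e]; exists (a *: N); rewrite linearZ /= e scalerDr scalerAr.
have Pprod (r : seq 'I_n) (Q : pred 'I_n) (x : 'I_n -> 'rV[K]_n) :
    P (\prod_(i <- r | Q i) ext_vec (x i)).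
  elim: r => [|i r [N e]]; first by exists 0; rewrite big_nil ext_map1 mulr0 addr0.
  rewrite big_cons; case: (Q i); last by exists N.
  move: (\prod_(_ <- _ | _) _) e => M e; pose a := (x i *m l) 0 0.
  (* Expand [x i - a v] against [ext_map A M], using the hypothesis on the [x i] term only; moving
     [v] past [x i] gives the sign. *)
  exists (- (a *: ext_map A M) - ext_vec (x i) * N).
  rewrite ext_mapM mulmxBr mulmx1 mulmxA [x i *m l]mx11_scalar mul_scalar_mx -/a.
  rewrite linearB linearZ /= -/(vec v) mulrBl {1}e mulrDr -scalerAl mulrBr mulrN.
  have -> : vec v * (ext_vec (x i) * N) = - (ext_vec (x i) * (vec v * N)).
    by rewrite !mulrA /vec ext_vecC mulNr.
  by rewrite opprK -scalerAr [- _ + _]addrC addrA.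
rewrite -[L]ext_map_id /ext_map; rewrite -/(P _).
elim/big_ind: _ => [|x y|S _]; [|exact: PD|exact/PZ/Pprod].
by exists 0; rewrite linear0 mulr0 addr0.
Qed.

Lemma ext_shear_id v u M :
  contraction g (vec v) M = 0 -> ext_shear v u M = M.
Proof.
move/contraction_eq0P => vM; apply: (ext_dotp_inj (g := g)) => L.
rewrite ext_dotp_shear /ext_shear; have [N ->] := ext_map_rank1 (\col_i dotp g u (b i)) v L.
by rewrite ext_dotpDl vM addr0.
Qed.

(** If some [dotp g v x] were nonzero, one shear would both fix and kill the blade. Conversely, a
    shear along [v] fixes the blade while its adjoint kills [v]. *)
Lemma contraction_factorP v c (s : seq X) : c *: \prod_(x <- s) vec x != 0 ->
  contraction g (vec v) (c *: \prod_(x <- s) vec x) = 0 <->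
  {in s, forall x, dotp g v x = 0}.
Proof.
set B := c *: _ => B0; split=> [vB x xs|vs].
  apply/eqP; apply: contraNT B0 => vx0.
  rewrite -(ext_shear_id ((dotp g v x)^-1 *: x) vB) /B linearZ /=.
  rewrite (ext_shear_blade0 xs) ?scaler0 //.
  by rewrite /shear scalerA divff // scale1r subrr.
apply/contraction_eq0P => L.
have [->|v0] := eqVneq v 0; first by rewrite linear0 mul0r ext_dotp0l.
have vv0 : dotp g v v != 0 by apply: contra_neq v0; exact: dotp_eq0.
pose u := (dotp g v v)^-1 *: v.
have <- : ext_shear v u B = B by rewrite /B linearZ /= ext_shear_fix.
rewrite ext_dotp_shear ext_shearM (_ : shear u v v = 0) ?linear0 ?mul0r ?ext_dotp0l //.
by rewrite /shear dotpZl fmorphV -dotpC mulVf // scale1r subrr.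
Qed.

(** * Orthogonal projection and outer spaces *)

Definition dotp_row (U : {vspace X}) v : 'rV[K]_(\dim U) :=
  \row_i dotp g (vbasis U)`_i v.

Fact dotp_row_is_linear U : linear (dotp_row U).
Proof.
by move=> a x y; apply/rowP => i; rewrite !mxE /dotp linearDl linearZl_LR.
Qed.

HB.instance Definition _ U :=
  GRing.isLinear.Build K X _ _ (dotp_row U) (dotp_row_is_linear U).

(** Definiteness makes [dotp_row U] injective on [U], hence onto by dimension; [u] is a preimage of
    its value at [w]. *)
Lemma orthogonal_decomposition (U : {vspace X}) w :
  exists2 u, u \in U & {in U, forall x, dotp g x (w - u) = 0}.
Proof.
pose F := linfun (dotp_row U).
have FE x : F x = dotp_row U x by rewrite lfunE.
have f0 x : dotp_row U x = 0 -> {in U, forall y, dotp g y x = 0}.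
  move=> /rowP fx y /coord_vbasis->; rewrite dotp_suml big1 // => i _.
  by have := fx i; rewrite dotpZl !mxE => ->; rewrite mulr0.
have UF : (U :&: lker F)%VS = 0%VS.
  apply/eqP; rewrite -subv0; apply/subvP => x; rewrite memv_cap memv_ker memv0 FE.
  by move=> /andP[xU /eqP/f0 fx]; apply/eqP/(@dotp_eq0 _ _ _ g)/fx.
have /memv_imgP[u uU eu] : F w \in (F @: U)%VS.
  suff -> : (F @: U)%VS = fullv by rewrite memvf.
  by apply/eqP; rewrite eqEdim subvf limg_dim_eq // dimvf /dim /= mul1n.
exists u => //; apply: f0; apply/eqP; rewrite -FE linearB /= subr_eq0; exact/eqP.
Qed.

(** The outer space is the double orthogonal of [U]: an element minus its projection is orthogonal
    to itself. *)
Lemma outer_spaceE M (U : {vspace X}) :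
  (forall v, contraction g (vec v) M = 0 <-> {in U, forall x, dotp g v x = 0}) ->
  outer_space g M = [set x | x \in U]%classic.
Proof.
move=> MU; apply/seteqP; split=> [w Mw|w wU v /= /MU vU]; last exact: vU.
have [u uU uw] := orthogonal_decomposition U w.
have wuM : contraction g (vec (w - u)) M = 0.
  by apply/MU => x xU; rewrite dotpC uw // rmorph0.
suff /dotp_eq0/subr0_eq-> : dotp g (w - u) (w - u) = 0 by [].
have dwu : dotp g (w - u) w = 0 by exact: Mw.
have duw : dotp g (w - u) u = 0 by rewrite dotpC uw // rmorph0.
by rewrite /dotp linearBl /= -/(dotp g _ w) -/(dotp g _ u) dwu duw subr0.
Qed.

(** * Minimal decompositions *)

(** A zero term could be dropped. This serves for [B] itself and for its sheared variants of equal
    length. *)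
Lemma minimal_blade_neq0 M k (B B' : 'I_k -> multivector K X) i :
  minimal_blade_decomposition M B -> blade_decomposition M B' -> B' i != 0.
Proof.
case: k i => [[]//|k] i in B B' * => [[_ Bmin]] [bB' eM].
apply/eqP => Bi; suff /Bmin : blade_decomposition M (B' \o lift i) by rewrite ltnn.
split=> [j|]; first exact: bB'.
by rewrite eM (bigD1_ord i) //= Bi add0r.
Qed.

Lemma minimal_inner M k (B : 'I_k -> multivector K X) v i :
  minimal_blade_decomposition M B -> vec v * M = 0 -> vec v * B i = 0.
Proof.
move=> Bmin vM; have [bB eM] := Bmin.1; have [c [s Bi]] := (is_bladeP (B i)).1 (bB i).
(* As [t] is orthogonal to the factors of [B i], [dotp g t v = dotp g t t], which vanishes only if
   [v] is in their span. *)
have [u us uv] := orthogonal_decomposition <<s>> v; pose t := v - u.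
have [t0|t0] := eqVneq t 0.
  by rewrite Bi -scalerAr vec_mul_blade0 ?scaler0 // [v](subr0_eq t0).
have ts : {in <<s>>%VS, forall x, dotp g t x = 0}.
  by move=> x xs; rewrite dotpC uv // rmorph0.
have tv0 : dotp g t v != 0.
  apply: contra_neq t0 => tv; apply: (@dotp_eq0 _ _ _ g).
  by rewrite {2}/t /dotp linearBl /= -!/(dotp g _ _) tv ts // subr0.
pose v' := (dotp g t v)^-1 *: v.
have v'M : ext_shear t v' M = 0.
  apply: ext_shear_ann; first by rewrite dotpZr mulVf.
  by rewrite linearZ -scalerAl vM scaler0.
have dec : blade_decomposition M (fun j => B j - ext_shear t v' (B j)).
  split=> [j|]; first exact/is_blade_sub_shear/bB.
  by rewrite sumrB -eM -linear_sum -eM /= v'M subr0.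
have /eqP[] := minimal_blade_neq0 i Bmin dec.
rewrite Bi linearZ /= ext_shear_fix ?subrr // => x xs.
by rewrite ts // memv_span.
Qed.

Lemma minimal_contraction M k (B : 'I_k -> multivector K X) v i :
  minimal_blade_decomposition M B -> contraction g (vec v) M = 0 ->
  contraction g (vec v) (B i) = 0.
Proof.
move=> Bmin vM; have [bB eM] := Bmin.1; have [c [s Bi]] := (is_bladeP (B i)).1 (bB i).
have Bi0 : c *: \prod_(x <- s) vec x != 0 by rewrite -Bi (minimal_blade_neq0 i Bmin Bmin.1).
rewrite Bi; apply/contraction_factorP => // x xs; apply/eqP/negPn/negP => vx0.
pose u := (dotp g v x)^-1 *: x.
have dec : blade_decomposition M (fun j => ext_shear v u (B j)).
  split=> [j|]; first exact/is_blade_shear/bB.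
  by rewrite -linear_sum -eM /= ext_shear_id.
have /eqP[] := minimal_blade_neq0 i Bmin dec.
rewrite Bi linearZ /= (ext_shear_blade0 xs) ?scaler0 //.
by rewrite /shear scalerA divff // scale1r subrr.
Qed.

Lemma minimal_blade_decomposition_balanced M k (B : 'I_k -> multivector K X) :
  minimal_blade_decomposition M B -> balanced g M B.
Proof.
move=> Bmin; have [bB eM] := Bmin.1; split.
  apply/seteqP; split=> [v vM i _|v vB]; first exact: minimal_inner Bmin vM.
  by rewrite /inner_space /= eM mulr_sumr big1 // => i _; exact: vB.
have /choice[s Bs] : forall i, exists s : seq X, forall v,
    contraction g (vec v) (B i) = 0 <-> {in s, forall x, dotp g v x = 0}.
  move=> i; have [c [s Bi]] := (is_bladeP (B i)).1 (bB i); exists s => v.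
  by rewrite Bi; apply: contraction_factorP; rewrite -Bi (minimal_blade_neq0 i Bmin Bmin.1).
have spanP (r : seq X) v :
    {in r, forall x, dotp g v x = 0} <-> {in <<r>>%VS, forall x, dotp g v x = 0}.
  split=> vr x xr; last by rewrite vr // memv_span.
  rewrite (coord_span (X := in_tuple r) xr) dotp_sumr big1 // => j _.
  by rewrite dotpZr vr ?mulr0 // mem_nth.
have outerB i : outer_space g (B i) = [set x | x \in <<s i>>%VS]%classic.
  by apply: outer_spaceE => v; rewrite Bs.
(* By minimality, a vector contracts [M] to 0 exactly when it does so to every [B i], that is, when
   it is orthogonal to all the spans. *)
rewrite (outer_spaceE (U := (\sum_i <<s i>>)%VS)).
  apply/seteqP; split=> [x /memv_sumP[y ys ->]|_ [y ys ->]].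
    by exists y => // i; rewrite outerB; exact: ys.
  by apply/memv_sumP; exists y => // i _; have := ys i; rewrite outerB.
move=> v; split=> [vM x /memv_sumP[y ys ->]|vs].
  rewrite dotp_sumr big1 // => i _; apply: ((spanP (s i) v).1 _ _ (ys i isT)).
  by apply/Bs; exact: minimal_contraction Bmin vM.
have vB i : contraction g (vec v) (B i) = 0.
  apply/Bs/spanP => x xs; apply: vs.
  by apply/(subvP _ _ xs)/(@sumv_sup _ _ _ i).
apply/contraction_eq0P => L; rewrite eM.
elim/big_ind: _ => [|M1 M2 e1 e2|i _]; first exact: ext_dotp0r.
  by rewrite ext_dotpDr e1 e2 addr0.
exact: ((contraction_eq0P v (B i)).1 (vB i) L).
Qed.

End Shear.

Theorem theorem3p8 (R : realType) :
  (forall (X : vectType R) (g : {dot X for @idfun R})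
      (M : multivector R X) (k : nat) (B : 'I_k -> multivector R X),
    minimal_blade_decomposition M B -> balanced g M B) /\
  (forall (X : vectType R[i]) (g : {dot X for @Num.conj R[i]})
      (M : multivector R[i] X) (k : nat) (B : 'I_k -> multivector R[i] X),
    minimal_blade_decomposition M B -> balanced g M B).
Proof.
(* Here [theta] is the identity, respectively complex conjugation. *)
by split=> X g M k B; exact: minimal_blade_decomposition_balanced.
Qed.
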